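(* Let $n\ge1$ be an integer, let $p\in\mathcal{P}_n$ and let $\mu\in S(p)$. Then $n\ge\log_2(|\mu|+1)$.
   Context: $\Delta=\{z\in\mathbb{C}:|z|<1\}$. $\mathcal{P}_n$ denotes the set of all polynomials $p(z)=a_n+a_{n-1}z+\dots+a_1z^{n-1}$ with complex coefficients, $a_1\neq0$, normalized by $p(1)=1$. For $p\in\mathcal{P}_n$, $S(p)=\{\mu\in\mathbb{C}:\text{all roots of } z^n-\mu p(z)\text{ lie in }\Delta\}$. *)

(* Defs.v *)
From mathcomp Require Import all_boot all_order all_algebra.
From mathcomp Require Import complex.
From mathcomp Require Import boolp classical_sets reals exp.

Set Implicit Arguments.
Unset Strict Implicit.
Unset Printing Implicit Defensive.

Import Order.TTheory GRing.Theory Num.Theory.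

Local Open Scope classical_set_scope.
Local Open Scope ring_scope.

Section Defs.
Variable R : realType.

(* [Normc.normc z] is the R-valued modulus; [`|z|] would have type R[i]. *)
Definition unit_disc : set R[i] := [set z | Normc.normc z < 1].

(* For n >= 1, [size p = n] says that p has degree exactly n - 1, i.e.
   p(z) = a_n + a_{n-1} z + ... + a_1 z^(n-1) with a_1 != 0; the class is
   empty for n = 0. *)
Definition normalized_poly (n : nat) : set {poly R[i]} :=
  [set p : {poly R[i]} | size p = n /\ p.[1] = 1].

Definition stable_multipliers (n : nat) (p : {poly R[i]}) : set R[i] :=
  [set mu | forall z : R[i], root ('X^n - mu *: p) z -> unit_disc z].

Definition log2 (x : R) : R := ln x / ln 2.

End Defs.

(* Main.v *)
(* The polynomial q = z^n - mu p(z) is monic of degree n and mu = 1 - q(1).  If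
   r_1, ..., r_n are its roots, expanding 1 - \prod_i (1 - r_i) and bounding
   every |r_i| by 1 gives |mu| <= 2^n - 1. *)
Require Import Defs.
From mathcomp Require Import all_boot all_order all_algebra.
From mathcomp Require Import complex.
From mathcomp Require Import boolp classical_sets reals exp.

Import Order.TTheory GRing.Theory Num.Theory.

Local Open Scope classical_set_scope.
Local Open Scope ring_scope.

(** Induction on [s]: with [P] the product over the tail, [1 - (1 - r) * P = (1 - P) + r * P].
    Keeping [+ 1] on the left makes the induction hypothesis bound both [|1 - P| + 1] and [|P|] by
    the same power of 2, so the bound doubles at each root. *)
Lemma ler_norm_prod1B (K : numDomainType) (s : seq K) :
  {in s, forall r, `|r| <= 1} ->
  `|1 - \prod_(r <- s) (1 - r)| + 1 <= 2 ^+ size s.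
Proof.
elim: s => [|r s IHs] s_le1; first by rewrite big_nil subrr normr0 add0r.
have r_le1 : `|r| <= 1 by rewrite s_le1 ?mem_head.
have {}IHs : `|1 - \prod_(x <- s) (1 - x)| + 1 <= 2 ^+ size s.
  by apply: IHs => x xs; rewrite s_le1 // inE xs orbT.
rewrite big_cons /= exprS mulr_natl mulr2n.
set P := \prod_(x <- s) _ in IHs *.
(* Triangle inequality for [P = 1 - (1 - P)]. *)
have P_le : `|P| <= 2 ^+ size s.
  apply: le_trans IHs; rewrite -[P in leLHS](subKr 1) [leRHS]addrC.
  by rewrite (le_trans (ler_normB _ _)) // normr1.
have -> : 1 - (1 - r) * P = (1 - P) + r * P.
  by rewrite mulrBl mul1r opprB addrA addrAC.
apply: le_trans (lerD IHs P_le).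
rewrite [leRHS]addrAC lerD2r (le_trans (ler_normD _ _)) // lerD2l normrM.
by rewrite ler_piMl.
Qed.

(** Being monic, [q] splits as a product of factors ['X - r], so [q.[1]] is the product of the
    [1 - r]. *)
Lemma monic_horner1_bound (K : numClosedFieldType) (q : {poly K}) :
  q \is monic -> (forall z, root q z -> `|z| <= 1) ->
  `|1 - q.[1]| + 1 <= 2 ^+ (size q).-1.
Proof.
move=> q_monic q_roots.
have [s def_q] := closed_field_poly_normal q.
rewrite (monicP q_monic) scale1r in def_q.
rewrite def_q size_prod_XsubC /= horner_prod.
under eq_bigr do rewrite hornerXsubC.
apply: ler_norm_prod1B => r rs.
by apply: q_roots; rewrite def_q root_prod_XsubC.
Qed.

Theorem theorem3 (R : realType) (n : nat) (hn : (1 <= n)%N)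
    (p : {poly R[i]}) (hp : normalized_poly n p)
    (mu : R[i]) (hmu : stable_multipliers n p mu) :
  n%:R >= log2 (Normc.normc mu + 1).
Proof.
case: hp => size_p p1.
have normE (z : R[i]) : `|z| = (Normc.normc z)%:C%C by case: z.
(* Only an upper bound on the size of [mu *: p] is used, so [mu = 0] is covered. *)
have size_lt : (size (- (mu *: p))%R < size ('X^n : {poly R[i]}))%N.
  by rewrite size_polyN size_polyXn ltnS -size_p size_scale_leq.
have size_q : size ('X^n - mu *: p) = n.+1 by rewrite size_polyDl // size_polyXn.
have q_monic : 'X^n - mu *: p \is monic.
  by rewrite monicE lead_coefDl // lead_coefXn.
have mu_le : Normc.normc mu + 1 <= 2 ^+ n.
  have q_roots z : root ('X^n - mu *: p) z -> `|z| <= 1.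
    by move=> /hmu/ltW z_le1; rewrite normE lecR.
  have := monic_horner1_bound _ _ q_monic q_roots.
  rewrite size_q /= hornerD hornerXn hornerN hornerZ p1 expr1n mulr1 subKr.
  (* The bound obtained lives in [R[i]]; the real goal is embedded there to match it. *)
  by rewrite -lecR rmorphD rmorphXn rmorph1 rmorph_nat /= -normE.
have mu_gt0 : 0 < Normc.normc mu + 1.
  by rewrite ltr_wpDl // -lecR -normE; apply: normr_ge0.
rewrite /log2 ler_pdivrMr ?ln_gt0 ?ltr1n // mulr_natl -lnXn // ler_ln ?posrE //.
by rewrite exprn_gt0.
Qed.
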